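(* Fix a cooperative Markov game, target and avoid sets, and a stationary joint policy $\pi$ as described in the context. Let $f:(\mathbf S\times\mathbf A)^*\to\{0,1\}$ be arbitrary. Communication availability at time $t$ is $\lambda_t=f(\mathbf s_0\mathbf a_0\cdots\mathbf s_{t-1}\mathbf a_{t-1})$, with $\lambda_0=f(\varepsilon)$. Let $v^{img}$ be the reach-avoid probability under imaginary play (Algorithm 1) with loss time $t_{loss}=\min\{t:\lambda_t=0\}$, where $\min\emptyset=\infty$. Then $$v^{img}\ge v^{full}-\sqrt{1-\exp(-C_\pi)}.$$
   Context: Multiagent model: there are $N$ agents. Agent $i$ is modeled by a finite MDP $\mathcal{M}^i=(\mathcal{S}^i,s_I^i,\mathcal{A}^i,\mathcal{T}^i)$. Here $\mathcal{S}^i$ is a finite state set, $s_I^i\in\mathcal{S}^i$ is the initial state, $\mathcal{A}^i$ is a finite action set, and $\mathcal{T}^i:\mathcal{S}^i\times\mathcal{A}^i\to\Delta(\mathcal{S}^i)$ is the transition kernel. The cooperative Markov game has joint state set $\mathbf{S}=\prod_i\mathcal{S}^i$, joint initial state $\mathbf{s}_I=(s_I^1,\dots,s_I^N)$, and joint action set $\mathbf{A}=\prod_i\mathcal{A}^i$. Its transition kernel is $\mathbf{T}(\mathbf{s},\mathbf{a},\mathbf{y})=\prod_{i}\mathcal{T}^i(s^i,a^i,y^i)$. A stationary joint policy is a map $\pi:\mathbf{S}\to\Delta(\mathbf{A})$. A joint path is an infinite sequence $\mathbf{s}_0\mathbf{a}_0\mathbf{s}_1\mathbf{a}_1\cdots\in(\mathbf{S}\times\mathbf{A})^\omega$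 with $\mathbf{s}_0=\mathbf{s}_I$. All random sampling below is mutually independent given the stated conditioning. Full-communication execution: at each time $t$, $\mathbf{a}_t\sim\pi(\mathbf{s}_t)$ is drawn once for the whole team. Each agent $i$ then moves to $s^i_{t+1}\sim\mathcal{T}^i(s^i_t,a^i_t)$. $\Gamma^{full}$ denotes the resulting distribution over joint paths. Imaginary play with loss time $t_{loss}\in\{0,1,\dots\}\cup\{\infty\}$ (Algorithm 1): - For $t<t_{loss}$, the team acts exactly as under full communication. Each agent $i$ records $\hat s^j_{t,i}=s^j_t$ for all $j\ne i$, and records $\hat{\mathbf a}_{t,i}=\mathbf a_t$. - For $t\ge t_{loss}$, each agent $i$ acts separately and does not observe the others. First it sets its imaginary teammate states. If $t=0$, it sets $\hat s^j_{0,i}=s_I^j$ for $j\neq i$. Otherwise it samples $\hat s^j_{t,i}\sim\mathcal{T}^j(\hat s^j_{t-1,i},\hat a^j_{t-1,i})$ for $j\ne i$, where $\hat a^j_{t-1,i}$ is the $j$-th component of $\hat{\mathbf a}_{t-1,i}$. - Agent $i$ then samples its own joint action $\hat{\mathbf a}_{t,i}\sim\pi(\hat s^1_{t,i},\dots,\hat s^{i-1}_{t,i},s^i_t,\hat s^{i+1}_{t,i},\dots,\hat s^N_{t,i})$. - Agent $i$ executes only its own component $\hat a^i_{t,i}$, and moves to $s^i_{t+1}\sim\mathcal{T}^i(s^i_t,\hat a^i_{t,i})$. - The realized joint action at time $t$ is $\mathbf a_t=(\hat a^1_{t,1},\dots,\hat a^N_{t,N})$. $\Gamma^{img}_{t_{loss}}$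 denotes the induced distribution over realized joint paths. Total correlation: let $\mathbf X$ be the random joint path under $\Gamma^{full}$, and $X^i$ its projection $s^i_0a^i_0s^i_1a^i_1\cdots$ onto agent $i$. The total correlation of $\pi$ is $$C_\pi=\Big[\sum_{i=1}^N H(X^i)\Big]-H(\mathbf X)=KL(\Gamma^{full}\|\Gamma^{img}_0).$$ The equality holds because $\Gamma^{img}_0$ is the product of the agents' marginal path distributions under $\Gamma^{full}$. Reach-avoid objective: a target set $\mathbf S_{\mathcal T}\subseteq\mathbf S$ and an avoid set $\mathbf S_{\mathcal A}\subseteq\mathbf S$ are given. A joint path succeeds if there is $M$ with $\mathbf s_M\in\mathbf S_{\mathcal T}$ and $\mathbf s_t\notin\mathbf S_{\mathcal A}$ for all $t<M$. $v^{full}$ is the success probability under $\Gamma^{full}$. *)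

(* Defs.v *)
From HB Require Import structures.
From mathcomp Require Import all_boot all_order all_algebra.
From mathcomp Require Import mathcomp_extra boolp classical_sets functions reals ereal.
From mathcomp Require Import topology normedtype sequences exp.
Set Implicit Arguments. Unset Strict Implicit. Unset Printing Implicit Defensive.
Import Order.TTheory GRing.Theory Num.Theory.
Local Open Scope ring_scope.

Definition jS (N : nat) (S : 'I_N -> finType) : finType := {dffun forall i : 'I_N, S i}.
Definition jA (N : nat) (A : 'I_N -> finType) : finType := {dffun forall i : 'I_N, A i}.

Section Game.
Variable R : realType.
Variable N : nat.
Variables (S A : 'I_N -> finType).
Local Notation X := (jS S * jA A)%type.
Variable T : forall i : 'I_N, S i -> A i -> S i -> R.
Variable sI : jS S.
Variable pi : jS S -> jA A -> R.

Definition Tj (s : jS S) (a : jA A) (y : jS S) : R :=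
  \prod_(i < N) T (s i) (a i) (y i).

Fixpoint full_from (prev : X) (h : seq X) : R :=
  match h with
  | [::] => 1
  | x :: h' => Tj prev.1 prev.2 x.1 * pi x.1 x.2 * full_from x h'
  end.

Definition full_prob (h : seq X) : R :=
  match h with
  | [::] => 1
  | x :: h' => (x.1 == sI)%:R * pi x.1 x.2 * full_from x h'
  end.

(* Imaginary play (Algorithm 1) with t_loss = min{t | f(s_0a_0...s_{t-1}a_{t-1}) = 0}.
   Hidden data after step t: for each agent i, its (imaginary) joint state
   hat s_{t,i} (own component = real s^i_t) and its sampled joint action
   hat a_{t,i} (own component = real a^i_t). *)
Variable f : seq X -> bool.

Definition Hidden := {ffun 'I_N -> (jS S * jA A)%type}.

Definition lostb (past : seq X) : bool :=
  has (fun k => ~~ f (take k past)) (iota 0 (size past).+1).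

(* weight of realizing x = (s_t, a_t) with new hidden data h', given the
   realized history past = s_0a_0...s_{t-1}a_{t-1} and the previous
   realized pair and hidden data (None when t = 0). *)
Definition img_step (past : seq X) (prev : option (X * Hidden)) (x : X)
    (h' : Hidden) : R :=
  if ~~ lostb past then
    (match prev with
     | None => (x.1 == sI)%:R
     | Some (xp, _) => Tj xp.1 xp.2 x.1
     end) * pi x.1 x.2 * (h' == [ffun => x])%:R
  else
    (* separate execution: each agent i samples its imaginary joint state
       (own component being its real move) and its own joint action *)
    (\prod_(i < N)
       ((match prev with
         | None => ((h' i).1 == sI)%:R
         | Some (_, hp) => Tj (hp i).1 (hp i).2 (h' i).1
         end) * pi (h' i).1 (h' i).2))
    * [forall i, ((h' i).1 i == x.1 i) && ((h' i).2 i == x.2 i)]%:R.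

(* forward weights, indexed by the reversed realized history *)
Fixpoint img_alpha (r : seq X) : Hidden -> R :=
  match r with
  | [::] => fun _ => 0
  | x :: r' =>
      match r' with
      | [::] => fun h' => img_step [::] None x h'
      | xp :: _ => fun h' =>
          \sum_(hp : Hidden) img_alpha r' hp * img_step (rev r') (Some (xp, hp)) x h'
      end
  end.

Definition img_prob (h : seq X) : R :=
  if h is [::] then 1 else \sum_(hp : Hidden) img_alpha (rev h) hp.

End Game.

Section Objectives.
Variable R : realType.
Variable X : finType.

(* probability of the prefix event "success is witnessed within the first n
   steps", sup over n = probability of the (increasing) union = success prob *)
Definition reach_within {St : Type} (st : X -> St) (s0 : St)
    (ST SA : pred St) (h : seq X) : bool :=
  let s := map st h in
  has (fun M => ST (nth s0 s M) && all (fun t => ~~ SA (nth s0 s t)) (iota 0 M))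
      (iota 0 (size h)).

Definition reach_prob {St : Type} (st : X -> St) (s0 : St) (ST SA : pred St)
    (P : seq X -> R) : \bar R :=
  ereal_sup (range (fun n : nat =>
    (\sum_(h : n.-tuple X) P h * (reach_within st s0 ST SA h)%:R)%:E)).

(* KL divergence of path measures = sup over horizons of KL of prefix laws *)
Definition kl_term (p q : R) : \bar R :=
  if p == 0 then 0%E else if q == 0 then +oo%E else (p * ln (p / q))%:E.

Definition KL_prefix (P Q : seq X -> R) (n : nat) : \bar R :=
  (\sum_(h : n.-tuple X) kl_term (P h) (Q h))%E.

Definition path_KL (P Q : seq X -> R) : \bar R :=
  ereal_sup (range (KL_prefix P Q)).

(* sqrt(1 - exp(-C)), with exp(-(+oo)) = 0 *)
Definition sqrt_one_minus_exp_neg (c : \bar R) : R :=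
  match c with
  | EFin r => Num.sqrt (1 - expR (- r))
  | +oo%E => 1
  | -oo%E => 0
  end.
End Objectives.

(* total correlation C_pi = KL(Gamma^full || Gamma^img_0), Gamma^img_0 being
   imaginary play with t_loss = 0 (f constantly 0) *)
Definition total_correlation (R : realType) (N : nat) (S A : 'I_N -> finType)
    (T : forall i : 'I_N, S i -> A i -> S i -> R) (sI : jS S)
    (pi : jS S -> jA A -> R) : \bar R :=
  path_KL (full_prob T sI pi) (img_prob T sI pi (fun _ => false)).

(* Main.v *)
(* The success events are increasing unions of finite-horizon events, so it
   suffices to compare the laws of length-[n] prefixes.  Let P be the law of full
   communication, Q that of imaginary play with loss rule f, and Q0 the product
   of the agents' marginals.  The Bretagnolle-Huber inequality bounds the loss of
   success probability by sqrt (1 - exp (- KL(P || Q))), so it remains to see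
   KL(P || Q) <= KL(P || Q0), that is, E_P[ln Q0] <= E_P[ln Q].  After the loss Q
   is a product of the agents' marginals conditioned on the last joint state, so
   by induction on the horizon only one step needs an argument: revealing the
   first joint step to all agents does not decrease E_P[ln].  The gain splits
   into the total correlation of that step and, for each agent, the information
   it carries on that agent's future; both are nonnegative by Gibbs' inequality. *)
Require Import Defs.
From HB Require Import structures.
From mathcomp Require Import all_boot all_order all_algebra.
From mathcomp Require Import mathcomp_extra boolp classical_sets functions reals ereal.
From mathcomp Require Import topology normedtype sequences exp.
From mathcomp Require Import ring lra.
Import Order.TTheory GRing.Theory Num.Theory.
Local Open Scope ring_scope.
Set Implicit Arguments. Unset Strict Implicit. Unset Printing Implicit Defensive.

(** * Information inequalities on a finite type *)

Section FiniteInequalities.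
Variables (R : realType) (I : finType).
Implicit Types (p q : I -> R).

(** Weighted sum of [ln x <= x - 1] at [x = q i / p i]. The mass of [q] may be smaller than that of
    [p], as happens for products of marginals when some combinations of views come from no joint
    step. *)
Lemma gibbs p q :
    (forall i, 0 <= p i) -> (forall i, 0 <= q i) ->
    \sum_i q i <= \sum_i p i -> (forall i, 0 < p i -> 0 < q i) ->
  \sum_i p i * ln (q i) <= \sum_i p i * ln (p i).
Proof.
move=> p0 q0 qp pq; rewrite -subr_ge0 -sumrB.
apply: (@le_trans _ _ (\sum_i (p i - q i))); first by rewrite sumrB subr_ge0.
apply: ler_sum => i _; have := p0 i; rewrite le_eqVlt => /predU1P[<-|pi0].
  by rewrite !mul0r subr0 sub0r oppr_le0.
have qi0 := pq i pi0.
have lnqp : ln (q i) - ln (p i) <= q i / p i - 1.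
  rewrite -ln_div ?posrE//; have := @le_ln1Dx R (q i / p i - 1).
  by rewrite addrCA subrr addr0; apply; have := divr_gt0 qi0 pi0; lra.
have -> : p i - q i = p i * (1 - q i / p i) by field; rewrite gt_eqF.
by rewrite -mulrBr ler_pM2l//; lra.
Qed.

(** Lagrange's identity: twice the defect is a sum of squares. *)
Lemma cauchy_schwarz_sqr (P : pred I) (u v : I -> R) :
  (\sum_(i | P i) u i * v i) ^+ 2 <=
  (\sum_(i | P i) u i ^+ 2) * (\sum_(i | P i) v i ^+ 2).
Proof.
rewrite -subr_ge0 -(pmulr_rge0 _ (ltr0n R 2)).
suff -> : 2%:R * ((\sum_(i | P i) u i ^+ 2) * (\sum_(i | P i) v i ^+ 2)
      - (\sum_(i | P i) u i * v i) ^+ 2) =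
    \sum_(i | P i) \sum_(j | P j) (u i * v j - u j * v i) ^+ 2.
  by apply: sumr_ge0 => i _; apply: sumr_ge0 => j _; exact: sqr_ge0.
have E (a b : I -> R) : (\sum_(i | P i) a i) * (\sum_(i | P i) b i) =
    \sum_(i | P i) \sum_(j | P j) a i * b j.
  by rewrite mulr_suml; apply: eq_bigr => i _; rewrite mulr_sumr.
set U := \sum_(i | P i) u i ^+ 2; set V := \sum_(i | P i) v i ^+ 2.
set B := \sum_(i | P i) u i * v i.
transitivity (U * V + V * U - (B * B + B * B)); first by ring.
rewrite !E -!big_split -sumrB /=; apply: eq_bigr => i _.
rewrite -!big_split -sumrB /=; apply: eq_bigr => j _; ring.
Qed.

(* The tangent of exp at the mean gives Jensen's inequality. *)
Lemma jensen_expR p (t : I -> R) :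
    (forall i, 0 <= p i) -> \sum_i p i = 1 ->
  expR (\sum_i p i * t i) <= \sum_i p i * expR (t i).
Proof.
move=> p0 p1; set m := \sum_i p i * t i.
have -> : expR m = \sum_i p i * (expR m * (1 + (t i - m))).
  transitivity (expR m * (\sum_i p i * (1 - m) + \sum_i p i * t i)).
    by rewrite -mulr_suml p1 -/m; ring.
  rewrite -big_split mulr_sumr; apply: eq_bigr => i _ /=; ring.
apply: ler_sum => i _; apply: ler_wpM2l => //.
rewrite -[in leRHS](subrK m (t i)) [(t i - m + m)]addrC expRD.
by rewrite ler_wpM2l ?expR_ge0 ?expR_ge1Dx.
Qed.

(** The Bhattacharyya coefficient [\sum_i bc i] is at least [expR (- D / 2)] by Jensen, while
    Cauchy-Schwarz on [E] and on its complement bounds its square by [1 - (a - b) ^+ 2]. *)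
Lemma bretagnolle_huber p q (E : pred I) :
    (forall i, 0 <= p i) -> (forall i, 0 <= q i) ->
    \sum_i p i = 1 -> \sum_i q i <= 1 -> (forall i, 0 < p i -> 0 < q i) ->
  \sum_(i | E i) p i - \sum_(i | E i) q i <=
  Num.sqrt (1 - expR (- (\sum_i p i * ln (p i) - \sum_i p i * ln (q i)))).
Proof.
move=> p0 q0 p1 q1 pq; set D := \sum_i p i * ln (p i) - _.
set a := \sum_(i | E i) p i; set b := \sum_(i | E i) q i.
pose bc i := Num.sqrt (p i) * Num.sqrt (q i).
have BCge : expR (- D / 2) <= \sum_i bc i.
  pose t i : R := (ln (q i) - ln (p i)) / 2.
  have -> : - D / 2 = \sum_i p i * t i.
    rewrite /D opprB -sumrB mulr_suml; apply: eq_bigr => i _.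
    by rewrite /t mulrA mulrBr.
  apply: le_trans (jensen_expR t p0 p1) _; apply: ler_sum => i _.
  have := p0 i; rewrite le_eqVlt => /predU1P[<-|pi0].
    by rewrite mul0r mulr_ge0 ?sqrtr_ge0.
  have qi0 := pq i pi0.
  rewrite le_eqVlt; apply/orP; left; rewrite -(@eqrXn2 _ 2)//; last 2 first.
  - by rewrite mulr_ge0 ?p0 ?expR_ge0.
  - by rewrite mulr_ge0 ?sqrtr_ge0.
  rewrite /bc !exprMn !sqr_sqrtr ?p0 ?q0// -expRM_natl /t.
  have -> : 2%:R * ((ln (q i) - ln (p i)) / 2) = ln (q i) - ln (p i) by field.
  rewrite expRD expRN !lnK ?posrE//; apply/eqP; field; by rewrite gt_eqF.
pose X := \sum_(i | E i) bc i; pose Y := \sum_(i | ~~ E i) bc i.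
pose a' := \sum_(i | ~~ E i) p i; pose b' := \sum_(i | ~~ E i) q i.
have X0 : 0 <= X by apply: sumr_ge0 => i _; rewrite mulr_ge0 ?sqrtr_ge0.
have Y0 : 0 <= Y by apply: sumr_ge0 => i _; rewrite mulr_ge0 ?sqrtr_ge0.
have cs (P : pred I) : (\sum_(i | P i) bc i) ^+ 2 <=
    (\sum_(i | P i) p i) * (\sum_(i | P i) q i).
  rewrite (le_trans (cauchy_schwarz_sqr _ _ _))//.
  rewrite (eq_bigr p) ?(eq_bigr q (F1 := fun i => Num.sqrt (q i) ^+ 2))//.
  - by move=> i _; rewrite sqr_sqrtr.
  - by move=> i _; rewrite sqr_sqrtr.
have XX : X ^+ 2 <= a * b by exact: cs.
have YY : Y ^+ 2 <= a' * b' by exact: cs.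
have aa : a + a' = 1 by rewrite -p1 [RHS](bigID E).
have bb : b + b' <= 1 by rewrite (le_trans _ q1)// [leRHS](bigID E).
have a0 : 0 <= a by apply: sumr_ge0.
have a'0 : 0 <= a' by apply: sumr_ge0.
have b0 : 0 <= b by apply: sumr_ge0.
have b'0 : 0 <= b' by apply: sumr_ge0.
have XY : (X + Y) ^+ 2 <= 1 - (a - b) ^+ 2.
  have {}YY : Y ^+ 2 <= (1 - a) * (1 - b).
    apply: le_trans YY _; rewrite (_ : a' = 1 - a); last by lra.
    by apply: ler_wpM2l; lra.
  (* AM-GM for [a * (1 - a)] and [b * (1 - b)], whose product is also that of the bounds on [X ^+ 2]
     and [Y ^+ 2]. *)
  have XY4 : 4 * (X ^+ 2 * Y ^+ 2) <= (a * (1 - a) + b * (1 - b)) ^+ 2.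
    apply: (@le_trans _ _ (4 * ((a * b) * ((1 - a) * (1 - b))))).
      rewrite ler_pM2l//; apply: ler_pM; rewrite ?sqr_ge0//.
    have := sqr_ge0 (a * (1 - a) - b * (1 - b)); nra.
  have {}XY4 : 2 * (X * Y) <= a * (1 - a) + b * (1 - b).
    rewrite -(@ler_pXn2r _ 2)// ?nnegrE; last 2 first.
    - by rewrite !mulr_ge0.
    - by rewrite addr_ge0 ?mulr_ge0//; lra.
    by rewrite (le_trans _ XY4)// le_eqVlt; apply/orP; left; apply/eqP; ring.
  have -> : (X + Y) ^+ 2 = X ^+ 2 + Y ^+ 2 + 2 * (X * Y) by ring.
  nra.
have eD : expR (- D) <= 1 - (a - b) ^+ 2.
  have XYE : \sum_i bc i = X + Y by rewrite (bigID E).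
  apply: le_trans XY; rewrite -XYE -[- D](@divfK _ 2)//.
  by rewrite expRM_natr lerXn2r// ?nnegrE ?expR_ge0// XYE addr_ge0.
apply: (le_trans (ler_norm _)); rewrite -sqrtr_sqr; apply: ler_wsqrtr; lra.
Qed.
End FiniteInequalities.

(** * Finite sums over dependent functions and tuples *)

Lemma sum_dffun_prod (R : comPzRingType) (I : finType) (J : I -> finType)
    (F : forall i, J i -> R) :
  \sum_(y : {dffun forall i, J i}) \prod_i F i (y i) = \prod_i \sum_j F i j.
Proof.
rewrite (reindex (@dffun_of_fprod I J)); last exact/onW_bij/dffun_of_fprod_bij.
pose P i := [ffun j => F i j].
transitivity (\sum_(t : fprod J) \prod_i P i (t i)).
  by apply: eq_bigr => t _; apply: eq_bigr => i _; rewrite /P !ffunE.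
rewrite big_fprod.
have := bigA_distr_big_dep (fun i => tagged_with J i) (fun i j => untag 0 (P i) j).
move=> <- .
apply: eq_bigr => i _; rewrite -(big_tag (fun i => P i)).
by apply: eq_bigr => j _; rewrite /P ffunE.
Qed.

Lemma sum_tuple0 (V : nmodType) (X : finType) (F : seq X -> V) :
  \sum_(h : 0.-tuple X) F h = F [::].
Proof.
rewrite (bigD1 [tuple]) //= big1 ?addr0// => h /eqP[]; exact: tuple0.
Qed.

Lemma sum_tupleS (V : nmodType) (X : finType) n (F : seq X -> V) :
  \sum_(h : n.+1.-tuple X) F h = \sum_x \sum_(h : n.-tuple X) F (x :: h).
Proof.
rewrite pair_big /= (reindex (fun z : X * n.-tuple X => [tuple of z.1 :: z.2])).
  exact: eq_bigr.
exists (fun h => (thead h, [tuple of behead h])) => [[x h] _|h _] /=.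
  by congr pair; apply: val_inj.
by rewrite -tuple_eta.
Qed.

Lemma ln_prod (R : realType) (I : Type) (r : seq I) (F : I -> R) :
  (forall i, 0 < F i) -> ln (\prod_(i <- r) F i) = \sum_(i <- r) ln (F i).
Proof.
move=> F0; elim: r => [|i r IH]; first by rewrite !big_nil ln1.
by rewrite !big_cons lnM ?IH// posrE// prodr_gt0.
Qed.

Lemma sum_subsingleton_le1 (R : numDomainType) (X : finType) (P : pred X) :
    (forall x y, P x -> P y -> x = y) ->
  \sum_x (P x)%:R <= 1 :> R.
Proof.
move=> P1; case: (pickP P) => [x Px|P0]; last first.
  by rewrite big1 ?ler01// => x _; rewrite P0.
rewrite (bigD1 x)//= Px big1 ?addr0// => y; case Py: (P y) => //.
by rewrite (P1 _ _ Py Px) eqxx.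
Qed.

(** * Path laws of a kernel, their local marginals, and loss of communication *)

Section Kernel.
Variables (R : realType) (I X : finType) (Y : I -> finType).
Variables (pr : forall i, X -> Y i) (k : option X -> X -> R).
Hypothesis pr_inj : forall x y, (forall i, pr i x = pr i y) -> x = y.
Hypothesis k_ge0 : forall p x, 0 <= k p x.
Hypothesis k_sum1 : forall p, \sum_x k p x = 1.

(** [None] stands for the time before the first step, so that the initial law and the transitions
    form one kernel. *)
Fixpoint path_law (p : option X) (h : seq X) : R :=
  if h is x :: h' then k p x * path_law (Some x) h' else 1.

(** The recursion tracks the whole joint step because the local process alone need not be Markov. *)
Fixpoint marg (i : I) (p : option X) (w : seq (Y i)) : R :=
  if w is a :: w' then \sum_(y | pr i y == a) k p y * marg (Some y) w' else 1.

Definition prod_law (p : option X) (h : seq X) : R :=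
  \prod_i marg p (map (pr i) h).

(** The test precedes the draw of the next step, and at a loss all agents start independent play
    from the same joint step [p]. *)
Fixpoint lossy_law (l : pred (seq X)) (past : seq X) (p : option X)
    (h : seq X) : R :=
  if l past then prod_law p h
  else if h is x :: h' then k p x * lossy_law l (rcons past x) (Some x) h'
  else 1.

Lemma path_law_ge0 p h : 0 <= path_law p h.
Proof. by elim: h p => //= x h IH p; rewrite mulr_ge0. Qed.

Lemma marg_ge0 i p (w : seq (Y i)) : 0 <= marg p w.
Proof. by elim: w p => //= a w IH p; rewrite sumr_ge0// => y _; rewrite mulr_ge0. Qed.

Lemma prod_law_ge0 p h : 0 <= prod_law p h.
Proof. by apply: prodr_ge0 => i _; exact: marg_ge0. Qed.

Lemma lossy_law_ge0 l past p h : 0 <= lossy_law l past p h.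
Proof.
elim: h past p => [|x h IH] past p /=; case: (l past) => //;
  by rewrite ?prod_law_ge0 ?mulr_ge0.
Qed.

Lemma le_marg_cons i p x (w : seq (Y i)) :
  k p x * marg (Some x) w <= marg p (pr i x :: w).
Proof.
rewrite /= (bigD1 x)//= lerDl sumr_ge0// => y _.
by rewrite mulr_ge0 ?marg_ge0.
Qed.

Lemma path_law_le_marg i p h : path_law p h <= marg p (map (pr i) h).
Proof.
elim: h p => //= x h IH p; apply: le_trans (le_marg_cons p x _).
by rewrite ler_wpM2l.
Qed.

(** Each marginal dominates the joint law. This absolute continuity keeps the default value
    [ln 0 = 0] from affecting the expectations. *)
Lemma prod_law_gt0 p h : 0 < path_law p h -> 0 < prod_law p h.
Proof.
by move=> h0; apply: prodr_gt0 => i _; exact: lt_le_trans (path_law_le_marg i _ _).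
Qed.

Lemma path_law_cons_gt0 p x h :
  0 < path_law p (x :: h) -> 0 < k p x /\ 0 < path_law (Some x) h.
Proof.
rewrite /= => kW; have [k0 W0] := (k_ge0 p x, path_law_ge0 (Some x) h).
by split; rewrite lt0r ?k0 ?W0 andbT; apply: contraTneq kW => ->;
  rewrite ?mul0r ?mulr0 ltxx.
Qed.

Lemma lossy_law_gt0 l past p h : 0 < path_law p h -> 0 < lossy_law l past p h.
Proof.
elim: h past p => [|x h IH] past p h0 /=; case: (l past) => //;
  try exact: prod_law_gt0.
by have [k0 W0] := path_law_cons_gt0 h0; rewrite mulr_gt0 ?IH.
Qed.

(** Change of variables: [marg] is the image of [path_law] under the local view, as seen by grouping
    first steps with the same view. *)
Lemma sum_path_law_marg i n p (g : seq (Y i) -> R) :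
  \sum_(h : n.-tuple X) path_law p h * g (map (pr i) h) =
  \sum_(w : n.-tuple (Y i)) marg p w * g w.
Proof.
elim: n p g => [|n IH] p g.
  rewrite (sum_tuple0 (fun h => path_law p h * g (map (pr i) h))).
  by rewrite (sum_tuple0 (fun w => marg p w * g w)).
rewrite (sum_tupleS _ (fun h => path_law p h * g (map (pr i) h))).
rewrite (sum_tupleS _ (fun w => marg p w * g w)) /=.
rewrite (partition_big (pr i) predT) //=; apply: eq_bigr => a _.
under [RHS]eq_bigr do rewrite mulr_suml.
rewrite [RHS]exchange_big /=; apply: eq_bigr => x /eqP <-.
under eq_bigr do rewrite -mulrA.
under [RHS]eq_bigr do rewrite -mulrA.
by rewrite -!mulr_sumr (IH _ (fun w => g (pr i x :: w))).
Qed.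

Lemma sum_path_law n p : \sum_(h : n.-tuple X) path_law p h = 1.
Proof.
elim: n p => [|n IH] p; first by rewrite (sum_tuple0 (path_law p)).
rewrite (sum_tupleS _ (path_law p)) -(k_sum1 p); apply: eq_bigr => x _ /=.
by rewrite -mulr_sumr IH mulr1.
Qed.

Lemma sum_marg i n p : \sum_(w : n.-tuple (Y i)) marg p w = 1.
Proof.
have := sum_path_law_marg n p (fun _ : seq (Y i) => 1).
under eq_bigr do rewrite mulr1.
by under [RHS]eq_bigr do rewrite mulr1; rewrite sum_path_law => <-.
Qed.

(* Each agent needs its own starting point, because after one step the agents
   no longer agree on the joint state. *)
Lemma sum_prod_marg_le1 n (p : I -> option X) :
  \sum_(h : n.-tuple X) \prod_i marg (p i) (map (pr i) h) <= 1.
Proof.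
elim: n p => [|n IH] p.
  rewrite (sum_tuple0 (fun h => \prod_i marg (p i) (map (pr i) h))).
  by rewrite big1.
rewrite (sum_tupleS _ (fun h => \prod_i marg (p i) (map (pr i) h))) /=.
(* [y i] is the joint step imagined by agent [i], and [c y x] says that each agent's own view in it
   is the one realized in [x]. *)
pose c (y : {ffun I -> X}) x := [forall i, pr i (y i) == pr i x].
pose K (y : {ffun I -> X}) := \prod_i k (p i) (y i).
pose M (y : {ffun I -> X}) (h : seq X) := \prod_i marg (Some (y i)) (map (pr i) h).
have E x (h : seq X) :
    \prod_i (\sum_(y | pr i y == pr i x) k (p i) y * marg (Some y) (map (pr i) h)) =
    \sum_(y : {ffun I -> X}) (c y x)%:R * (K y * M y h).
  under eq_bigr do rewrite big_mkcond.
  rewrite bigA_distr_bigA; apply: eq_bigr => y _; rewrite /K /M -big_split /=.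
  rewrite /c; case: (boolP [forall i, _]) => [/forallP ce|/forallPn[i /negPf ci]].
    by rewrite mul1r; apply: eq_bigr => i _; rewrite ce.
  by rewrite mul0r (bigD1 i)//= ci mul0r.
under eq_bigr do under eq_bigr do rewrite E.
under eq_bigr do rewrite exchange_big.
rewrite exchange_big /=.
have K1 : \sum_(y : {ffun I -> X}) K y = 1.
  by rewrite -(bigA_distr_bigA (fun i => k (p i))) big1.
rewrite -[leRHS]K1.
apply: ler_sum => y _.
have K0 : 0 <= K y by apply: prodr_ge0 => i _.
have M0 : 0 <= \sum_(h : n.-tuple X) M y h <= 1.
  rewrite IH andbT sumr_ge0// => h _; apply: prodr_ge0 => i _; exact: marg_ge0.
have -> : \sum_x \sum_(h : n.-tuple X) (c y x)%:R * (K y * M y h) =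
    (\sum_x (c y x)%:R) * (K y * \sum_(h : n.-tuple X) M y h).
  rewrite mulr_suml; apply: eq_bigr => x _.
  by rewrite !mulr_sumr.
(* By [pr_inj] a family [y] fits at most one realized step; it may fit none, hence an inequality. *)
have c1 : \sum_x (c y x)%:R <= 1 :> R.
  apply: sum_subsingleton_le1 => x x' /forallP cx /forallP cx'.
  by apply: pr_inj => i; rewrite -(eqP (cx i)) (eqP (cx' i)).
case/andP: M0 => M0 M1.
apply: (@le_trans _ _ (1 * (K y * 1))); last by rewrite mul1r mulr1.
rewrite ler_pM// ?sumr_ge0//; first by rewrite mulr_ge0.
by rewrite ler_wpM2l.
Qed.

Lemma sum_prod_law_le1 n p : \sum_(h : n.-tuple X) prod_law p h <= 1.
Proof. exact: sum_prod_marg_le1 n (fun=> p). Qed.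

Lemma sum_lossy_law_le1 l n past p :
  \sum_(h : n.-tuple X) lossy_law l past p h <= 1.
Proof.
elim: n past p => [|n IH] past p; have [lp|/negPf lp] := boolP (l past).
- rewrite (sum_tuple0 (lossy_law l past p)) /= lp.
  by rewrite -(sum_tuple0 (prod_law p)) sum_prod_law_le1.
- by rewrite (sum_tuple0 (lossy_law l past p)) /= lp.
- apply: le_trans (sum_prod_law_le1 _ p); rewrite le_eqVlt; apply/orP; left.
  by apply/eqP/eq_bigr => h _; case/tupleP: h => x h /=; rewrite lp.
rewrite (sum_tupleS _ (lossy_law l past p)) -(k_sum1 p) ; apply: ler_sum => x _ /=.
by rewrite lp -mulr_sumr -[leRHS]mulr1 ler_wpM2l.
Qed.

(* Gibbs' inequality applied to the first joint step and, agent by agent, to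
   the conditional law of that agent's future. *)
Lemma one_step_prod_law n p :
  \sum_(h : n.+1.-tuple X) path_law p h * ln (prod_law p h) <=
  \sum_x k p x * ln (k p x) +
  \sum_x k p x * \sum_(h : n.-tuple X) path_law (Some x) h * ln (prod_law (Some x) h).
Proof.
rewrite (sum_tupleS _ (fun h => path_law p h * ln (prod_law p h))) /=.
pose m x := \prod_i marg p [:: pr i x].
have m_gt0 x i : 0 < k p x -> 0 < marg p [:: pr i x].
  by move=> kx; apply: lt_le_trans (le_marg_cons _ _ _); rewrite mulr1.
(* Nonnegativity of the total correlation of one step; [m] has mass at most one by
   [sum_prod_law_le1] at horizon 1. *)
have : \sum_x k p x * ln (m x) <= \sum_x k p x * ln (k p x).
  apply: gibbs => //.
  - by move=> x; apply: prodr_ge0 => i _; exact: marg_ge0.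
  - rewrite k_sum1; have := sum_prod_law_le1 1 p.
    rewrite (sum_tupleS _ (prod_law p)) /=.
    by under eq_bigr do rewrite (sum_tuple0 (fun h => prod_law p (_ :: h))).
  - by move=> x kx; apply: prodr_gt0 => i _; exact: m_gt0.
rewrite -(lerD2r (\sum_x k p x * \sum_(h : n.-tuple X)
  path_law (Some x) h * ln (prod_law (Some x) h))); apply: le_trans.
rewrite -big_split /=; apply: ler_sum => x _; rewrite -mulrDr.
have := k_ge0 p x; rewrite le_eqVlt => /predU1P[<-|kx].
  by rewrite mul0r big1// => h _; rewrite !mul0r.
under eq_bigr do rewrite -mulrA; rewrite -mulr_sumr ler_pM2l//.
have lnE (h : seq X) q : 0 < path_law q h ->
    ln (prod_law q h) = \sum_i ln (marg q (map (pr i) h)).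
  move=> W0; rewrite /prod_law ln_prod// => i.
  exact: lt_le_trans (path_law_le_marg i _ _).
(* Given [x], the local future has law [marg (Some x)]. Gibbs compares it with the conditional law
   given only the agent's own first view, which is the quotient by [mi] below. *)
have step i : \sum_(h : n.-tuple X) path_law (Some x) h *
      ln (marg p (pr i x :: map (pr i) h)) <=
    ln (marg p [:: pr i x]) + \sum_(h : n.-tuple X) path_law (Some x) h *
      ln (marg (Some x) (map (pr i) h)).
  rewrite (sum_path_law_marg _ _ (fun w => ln (marg p (pr i x :: w)))).
  rewrite (sum_path_law_marg _ _ (fun w => ln (marg (Some x) w))).
  set mi := marg p [:: pr i x]; have mi0 : 0 < mi by exact: m_gt0.
  have pos (w : seq (Y i)) : 0 < marg (Some x) w -> 0 < marg p (pr i x :: w).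
    by move=> w0; apply: lt_le_trans (le_marg_cons _ _ _); rewrite mulr_gt0.
  rewrite -lerBlDl -[ln mi]mul1r -(sum_marg i n (Some x)) mulr_suml -sumrB.
  apply: le_trans (gibbs (q := fun w : n.-tuple (Y i) =>
      marg p (pr i x :: w) / mi) _ _ _ _); last 4 first.
  - by move=> w; exact: marg_ge0.
  - by move=> w; rewrite divr_ge0 ?marg_ge0.
  - rewrite sum_marg -mulr_suml ler_pdivrMr// mul1r /mi /=.
    rewrite exchange_big /=; apply: ler_sum => y _.
    by rewrite -mulr_sumr sum_marg mulr1.
  - by move=> w w0; rewrite divr_gt0 ?pos.
  rewrite le_eqVlt; apply/orP; left; apply/eqP/eq_bigr => w _.
  have := marg_ge0 (Some x) w; rewrite le_eqVlt => /predU1P[<-|w0].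
    by rewrite !mul0r subr0.
  by rewrite ln_div ?posrE ?pos// mulrBr.
have -> : ln (m x) = \sum_i ln (marg p [:: pr i x]).
  by rewrite /m ln_prod// => i; exact: m_gt0.
have -> : \sum_(h : n.-tuple X) path_law (Some x) h * ln (prod_law p (x :: h)) =
    \sum_i \sum_(h : n.-tuple X) path_law (Some x) h *
      ln (marg p (pr i x :: map (pr i) h)).
  rewrite exchange_big /=; apply: eq_bigr => h _; rewrite -mulr_sumr.
  have := path_law_ge0 (Some x) h; rewrite le_eqVlt => /predU1P[<-|W0].
    by rewrite !mul0r.
  by rewrite lnE//= mulr_gt0.
have -> : \sum_(h : n.-tuple X) path_law (Some x) h * ln (prod_law (Some x) h) =
    \sum_i \sum_(h : n.-tuple X) path_law (Some x) h *
      ln (marg (Some x) (map (pr i) h)).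
  rewrite exchange_big /=; apply: eq_bigr => h _; rewrite -mulr_sumr.
  have := path_law_ge0 (Some x) h; rewrite le_eqVlt => /predU1P[<-|W0].
    by rewrite !mul0r.
  by rewrite lnE.
by rewrite -big_split /=; apply: ler_sum => i _; exact: step.
Qed.

(** After a loss both sides coincide; otherwise [one_step_prod_law] reveals the joint step and the
    induction hypothesis treats the future from there. *)
Lemma cross_entropy_lossy_law l n past p :
  \sum_(h : n.-tuple X) path_law p h * ln (prod_law p h) <=
  \sum_(h : n.-tuple X) path_law p h * ln (lossy_law l past p h).
Proof.
elim: n past p => [|n IH] past p; have [lp|/negPf lp] := boolP (l past).
- by apply: ler_sum => h _; rewrite tuple0 /= lp.
- apply: ler_sum => h _; rewrite tuple0 /= lp /prod_law /=.
  by rewrite big1.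
- by apply: ler_sum => h _; case/tupleP: h => x h /=; rewrite lp.
apply: le_trans (one_step_prod_law _ _) _.
rewrite (sum_tupleS _ (fun h => path_law p h * ln (lossy_law l past p h))) /=.
rewrite -big_split /=; apply: ler_sum => x _; rewrite lp.
have := k_ge0 p x; rewrite le_eqVlt => /predU1P[<-|kx].
  by rewrite !mul0r add0r big1// => h _; rewrite !mul0r.
rewrite -mulrDr; under [leRHS]eq_bigr do rewrite -mulrA.
(* The constant [ln (k p x)] becomes an average over futures, whose law has mass one, so that it
   merges with the logarithms of the future weights. *)
rewrite -mulr_sumr ler_pM2l// -[ln (k p x)]mul1r -(sum_path_law n (Some x)).
rewrite mulr_suml.
apply: (@le_trans _ _ (\sum_(h : n.-tuple X) path_law (Some x) h * ln (k p x) +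
   \sum_(h : n.-tuple X) path_law (Some x) h *
     ln (lossy_law l (rcons past x) (Some x) h))); first by rewrite lerD2l.
rewrite -big_split /=; apply: ler_sum => h _; rewrite -mulrDr.
have := path_law_ge0 (Some x) h; rewrite le_eqVlt => /predU1P[<-|W0].
  by rewrite !mul0r.
by rewrite lnM ?posrE// lossy_law_gt0.
Qed.

(** Bretagnolle-Huber is applied against the lossy law; its divergence is then replaced by that of
    the product law, no smaller by [cross_entropy_lossy_law]. *)
Lemma lossy_law_event_bound l n p (E : pred (seq X)) :
  \sum_(h : n.-tuple X) path_law p h * (E h)%:R -
  Num.sqrt (1 - expR (- (\sum_(h : n.-tuple X) path_law p h * ln (path_law p h)
    - \sum_(h : n.-tuple X) path_law p h * ln (prod_law p h)))) <=
  \sum_(h : n.-tuple X) lossy_law l [::] p h * (E h)%:R.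
Proof.
have indic (F : seq X -> R) : \sum_(h : n.-tuple X) F h * (E h)%:R =
    \sum_(h : n.-tuple X | E h) F h.
  by rewrite [RHS]big_mkcond; apply: eq_bigr => h _; case: (E h);
    rewrite ?mulr1 ?mulr0.
rewrite !indic lerBlDl -lerBlDr.
apply: le_trans (bretagnolle_huber (fun h : n.-tuple X => E h)
    (p := fun h : n.-tuple X => path_law p h)
    (q := fun h : n.-tuple X => lossy_law l [::] p h) _ _ _ _ _) _.
- by move=> h; exact: path_law_ge0.
- by move=> h; exact: lossy_law_ge0.
- exact: sum_path_law.
- exact: sum_lossy_law_le1.
- by move=> h; exact: lossy_law_gt0.
apply: ler_wsqrtr; rewrite lerB// ler_expR lerN2 lerB//.
exact: cross_entropy_lossy_law.
Qed.
End Kernel.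

(** * Full communication and imaginary play as path laws of one kernel *)

Section Game.
Variables (R : realType) (N : nat) (S A : 'I_N -> finType).
Local Notation X := (jS S * jA A)%type.
Local Notation hidden := (Hidden S A).
Variables (T : forall i : 'I_N, S i -> A i -> S i -> R) (sI : jS S).
Variable pi : jS S -> jA A -> R.
Arguments T : clear implicits.
Hypothesis T_ge0 : forall i s a y, 0 <= T i s a y.
Hypothesis T_sum1 : forall i s a, \sum_(y : S i) T i s a y = 1.
Hypothesis pi_ge0 : forall s a, 0 <= pi s a.
Hypothesis pi_sum1 : forall s, \sum_(a : jA A) pi s a = 1.

Definition local_view (i : 'I_N) (x : X) : S i * A i := (x.1 i, x.2 i).

Definition joint_step (p : option X) (x : X) : R :=
  (if p is Some xp then Tj T xp.1 xp.2 x.1 else (x.1 == sI)%:R) * pi x.1 x.2.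

Lemma local_view_inj (x y : X) : (forall i, local_view i x = local_view i y) -> x = y.
Proof.
case: x y => [s a] [s' a'] /= xy; congr pair; apply/ffunP => i;
  by have [] := xy i.
Qed.

Lemma joint_step_ge0 p x : 0 <= joint_step p x.
Proof.
by rewrite mulr_ge0//; case: p => [y|]; rewrite ?ler0n// prodr_ge0.
Qed.

Lemma sum_joint_step p : \sum_x joint_step p x = 1.
Proof.
rewrite -(pair_bigA _ (fun s a => joint_step p (s, a))) /=.
rewrite /joint_step /=; under eq_bigr do rewrite -mulr_sumr pi_sum1 mulr1.
case: p => [y|]; last first.
  by rewrite (bigD1 sI)//= eqxx big1 ?addr0// => s /negPf ->.
by rewrite /Tj (sum_dffun_prod (fun i => T i (y.1 i) (y.2 i))) big1.
Qed.

Lemma full_probE h : full_prob T sI pi h = path_law joint_step None h.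
Proof.
have fromE y u : full_from T pi y u = path_law joint_step (Some y) u.
  by elim: u y => //= x u IH y; rewrite IH.
by case: h => //= x h; rewrite fromE.
Qed.

Variable f : seq X -> bool.

(** Prefixes of [past] stay prefixes, so a loss is permanent even if [f] later returns to [true]. *)
Lemma lostb_rcons past x : lostb f past -> lostb f (rcons past x).
Proof.
move=> /hasP[n]; rewrite mem_iota add0n ltnS => /andP[_ nle] fn.
apply/hasP; exists n; first by rewrite mem_iota add0n size_rcons ltnS leqW.
by rewrite -cats1 takel_cat.
Qed.

(* [img_prob] sums over the hidden data forward in time; summing backward lets
   the future be factored over agents once communication is lost. *)
Fixpoint img_future (past : seq X) (prev : option (X * hidden)) (h : seq X) : R :=
  if h is x :: h' then
    \sum_(z : hidden) img_step T sI pi f past prev x z *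
      img_future (rcons past x) (Some (x, z)) h'
  else 1.

Lemma img_prob_future h : img_prob T sI pi f h = img_future [::] None h.
Proof.
case: h => [|x h] //; rewrite /img_prob /=.
(* Forward weights up to a cut paired with backward weights after it give the same total wherever
   the cut lies; the induction moves the cut. *)
suff E past y u : \sum_z img_alpha T sI pi f (y :: rev past) z *
      img_future (rcons past y) (Some (y, z)) u =
    \sum_z img_alpha T sI pi f (rev (rcons past y ++ u)) z.
  by rewrite -(E [::] x h).
elim: u past y => [|v u IH] past y.
  by rewrite cats0 rev_rcons; apply: eq_bigr => z _; rewrite mulr1.
rewrite -cat_rcons -IH rev_rcons /=.
under eq_bigr do rewrite mulr_sumr.
rewrite exchange_big /=; apply: eq_bigr => z _.
rewrite mulr_suml; apply: eq_bigr => z' _.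
by rewrite mulrA rev_cons revK.
Qed.

(** After a loss the step weight is a product over agents, and each [z i] is constrained only by the
    view of agent [i]. The sum over [z] thus distributes into one marginal per agent, started from
    that agent's own hidden data. *)
Lemma img_future_lost past prev h : lostb f past ->
  img_future past prev h =
  \prod_i marg local_view joint_step (omap (fun xz : X * hidden => xz.2 i) prev) (map (local_view i) h).
Proof.
elim: h past prev => [|x h IH] past prev lp /=; first by rewrite big1.
under [RHS]eq_bigr do rewrite big_mkcond.
rewrite bigA_distr_bigA; apply: eq_bigr => z _.
rewrite (IH _ _ (lostb_rcons _ lp)) /img_step lp /=.
have -> : [forall i, ((z i).1 i == x.1 i) && ((z i).2 i == x.2 i)] =
    [forall i, local_view i (z i) == local_view i x] by [].
case: (boolP [forall i, _]) => [/forallP zx|/forallPn[i /negPf zx]].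
  rewrite mulr1 -big_split; apply: eq_bigr => i _ /=; rewrite zx.
  by rewrite /joint_step; case: prev => [[]|].
by rewrite mulr0 mul0r (bigD1 i)//= zx mul0r.
Qed.

(** While communication lasts every agent holds the realized pair, so only the constant family has
    weight; at a loss all marginals start from that pair. *)
Lemma img_future_lossy past p h :
  img_future past (omap (fun x : X => (x, [ffun=> x] : hidden)) p) h =
  lossy_law local_view joint_step (lostb f) past p h.
Proof.
elim: h past p => [|x h IH] past p /=; have [lp|/negPf lp] := boolP (lostb f past).
- by rewrite /prod_law big1.
- by [].
- transitivity (img_future past (omap (fun x : X => (x, [ffun=> x] : hidden)) p) (x :: h)) => //.
  rewrite img_future_lost//; apply: eq_bigr => i _.
  by case: p => //= y; rewrite ffunE.
rewrite (bigD1 [ffun=> x])//= big1 ?addr0; last first.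
  by move=> z /negPf zx; rewrite /img_step lp /= zx mulr0 mul0r.
rewrite (IH _ (Some x)) /img_step lp /= eqxx mulr1 /joint_step.
by case: p.
Qed.

Lemma img_probE h :
  img_prob T sI pi f h = lossy_law local_view joint_step (lostb f) [::] None h.
Proof. by rewrite img_prob_future (img_future_lossy [::] None). Qed.
End Game.

(** * From fixed horizons to divergences and probabilities of infinite paths *)

Lemma KL_prefixE (R : realType) (X : finType) (P Q : seq X -> R) n :
    (forall h, 0 <= P h) -> (forall h, 0 < P h -> 0 < Q h) ->
  KL_prefix P Q n = (\sum_(h : n.-tuple X) P h * ln (P h)
    - \sum_(h : n.-tuple X) P h * ln (Q h))%:E.
Proof.
move=> P0 PQ; rewrite -sumrB -sumEFin; apply: eq_bigr => h _; rewrite /kl_term.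
have := P0 h; rewrite le_eqVlt => /predU1P[<-|Ph].
  by rewrite eqxx !mul0r subr0.
by rewrite !gt_eqF ?PQ// ln_div ?posrE ?PQ// mulrBr.
Qed.

Lemma le_sqrt_one_minus_exp_neg (R : realType) (d : R) (c : \bar R) :
    (d%:E <= c)%E ->
  Num.sqrt (1 - expR (- d)) <= sqrt_one_minus_exp_neg c.
Proof.
case: c => [r|_|//] /=.
  by rewrite lee_fin => dr; rewrite ler_wsqrtr// lerB// ler_expR lerN2.
by rewrite -[leRHS]sqrtr1 ler_wsqrtr// gerBl expR_ge0.
Qed.

Theorem theorem1 (R : realType) (N : nat) (S A : 'I_N -> finType)
    (T : forall i : 'I_N, S i -> A i -> S i -> R) (sI : jS S)
    (pi : jS S -> jA A -> R) (ST SA : pred (jS S))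
    (f : seq (jS S * jA A) -> bool)
    (HT0 : forall i s a y, 0 <= T i s a y)
    (HT1 : forall i s a, \sum_(y : S i) T i s a y = 1)
    (Hpi0 : forall s a, 0 <= pi s a)
    (Hpi1 : forall s, \sum_(a : jA A) pi s a = 1) :
  (reach_prob fst sI ST SA (full_prob T sI pi)
     - (sqrt_one_minus_exp_neg (total_correlation T sI pi))%:E
   <= reach_prob fst sI ST SA (img_prob T sI pi f))%E.
Proof.
have k0 := joint_step_ge0 sI HT0 Hpi0.
have k1 := sum_joint_step sI HT1 Hpi1.
set k := joint_step T sI pi in k0 k1.
have -> : full_prob T sI pi = path_law k None.
  by apply/funext => h; exact: full_probE.
have -> : img_prob T sI pi f = lossy_law (@local_view _ S A) k (lostb f) [::] None.
  by apply/funext => h; exact: img_probE.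
(* Both probabilities are suprema over horizons; each horizon on the left is matched by the same one
   on the right. *)
rewrite leeBlDr//; apply: ge_ereal_sup => _ [n _ <-].
rewrite -leeBlDr//; apply: le_ereal_sup_tmp; eexists; first by exists n.
rewrite -EFinB lee_fin.
apply: le_trans (lossy_law_event_bound (@local_view_inj _ S A) k0 k1 (lostb f) n None
  (reach_within fst sI ST SA)).
rewrite lerB//; apply: le_sqrt_one_minus_exp_neg.
apply: le_ereal_sup_tmp; exists (KL_prefix (path_law k None)
  (prod_law (@local_view _ S A) k None) n).
  exists n => //; congr KL_prefix; apply/funext => h; first exact: full_probE.
  (* For [f] constantly [false] even the empty past is lost, so the lossy law is the product law
     from the start. *)
  by rewrite img_probE; case: h.
rewrite KL_prefixE// => h; first exact: path_law_ge0.
exact: prod_law_gt0.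
Qed.
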